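(* Let $\mathcal{T}$ be a tangle that is not one of the six basic stringable tangles. Then there exists a positive integer $n_0$ such that for every integer $n > n_0$, $\mathcal{T}$ does not guarantee envy-free connected allocations for $n$ agents with monotone continuous valuations.
   Context: A tangle is a connected topological space obtained by taking finitely many disjoint copies of the closed interval $[0,1]$ and identifying some of their endpoints (quotient topology); homeomorphic tangles are regarded as identical. Every point $x$ of a tangle has a small neighborhood homeomorphic to $k$ copies of $[0,1)$ with all the $0$'s identified (with $x$ corresponding to $0$); $k$ is the degree of $x$. Points of degree $1$ or of degree at least $3$ are singular. An edge of $\mathcal{T}$ is a connected component of the space obtained by removing all singular points of $\mathcal{T}$. The six basic stringable tangles are: the closed unit interval; the circle; the lollipop (a circle with a segment attached at one endpoint to one point of the circle); the figure 8 (two circles sharing exactly one point); the handcuffs (two disjoint circles joined by a segment whose endpoints lie one on each circle); and the theta $\Theta$ (two points joined by three internally disjoint arcs). A valuation on a tangle $\mathcal{T}$ assigns a nonnegative real number $\nu(X)$ to every connected subset $X \subseteq \mathcal{T}$. It is monotone continuous if (1) $\nu(\emptyset)=0$ and $\nu(X)\le\nu(Y)$ whenever $X\subseteq Y$ are connected subsets; and (2) fixing a homeomorphic identification of each of the $m$ edges $e_i$ of $\mathcal{T}$ with a copy $[0,1]_i$ of the unit interval, and letting, for $z=(x_1,y_1,\dots,x_m,y_m)$, $X(z)$ be the closed subset of $\mathcal{T}$ whose intersection with each $e_i$ corresponds to $[x_i,y_i]\cap[0,1]_i$, the function $z\mapsto \nu(X(z))$, restricted to those $z$ for which $X(z)$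 is closed and connected, is continuous. A connected allocation of $\mathcal{T}$ to agents $1,\dots,n$ is a tuple $(T_1,\dots,T_n)$ of pairwise disjoint connected subsets of $\mathcal{T}$ whose union is $\mathcal{T}$, $T_i$ being agent $i$'s share. Given valuations $\nu_1,\dots,\nu_n$, it is envy-free if $\nu_i(T_i)\ge\nu_i(T_j)$ for all $i,j$. $\mathcal{T}$ guarantees envy-free connected allocations for $n$ agents with monotone continuous valuations if for every choice of monotone continuous valuations $\nu_1,\dots,\nu_n$ on $\mathcal{T}$ an envy-free connected allocation exists. *)

(* Defs.v *)
From HB Require Import structures.
From mathcomp Require Import all_boot all_order all_algebra generic_quotient.
From mathcomp Require Import all_classical all_reals.
From mathcomp Require Import topology normedtype homotopy.
Import Order.TTheory GRing.Theory Num.Theory.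
Import numFieldNormedType.Exports.

Set Implicit Arguments.
Unset Strict Implicit.
Unset Printing Implicit Defensive.

Local Open Scope classical_set_scope.
Local Open Scope ring_scope.
Local Open Scope quotient_scope.

Definition homeomorphism (X Y : topologicalType) (f : X -> Y) : Prop :=
  continuous f /\
  exists g : Y -> X, [/\ cancel f g, cancel g f & continuous g].

Definition homeomorphic (X Y : topologicalType) : Prop :=
  exists f : X -> Y, homeomorphism f.

(* A gluing of m copies of [0,1] is coded by a list s of m pairs of labels:
   the pair at position i holds the labels of the endpoints 0 and 1 of the
   i-th copy, and two endpoints are identified iff they carry the same label.
   Every equivalence relation on the 2m endpoints arises in this way. *)
Section gluing.
Variables (R : realType) (s : seq (nat * nat)).

Definition copies : topologicalType :=
  {_ : 'I_(size s) & set_type [set` `[0 : R, 1]]}.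

Definition end_label (p : copies) : option nat :=
  let ends := nth (0%N, 0%N) s (tag p) in
  if set_val (tagged p) == 0 then Some ends.1
  else if set_val (tagged p) == 1 then Some ends.2
  else None.

Definition identified (p q : copies) : bool :=
  (p == q) || ((end_label p != None) && (end_label p == end_label q)).

Local Lemma glue_rel_refl : reflexive identified.
Proof. by move=> p; rewrite /identified eqxx. Qed.

Local Lemma glue_rel_sym : symmetric identified.
Proof.
move=> p q; rewrite /identified (eq_sym q p) (eq_sym (end_label q) (end_label p)).
by have [->|_] := eqVneq (end_label p) (end_label q); rewrite ?andbF.
Qed.

Local Lemma glue_rel_trans : transitive identified.
Proof.
move=> q p r /predU1P[-> //|/andP[pN /eqP pq]] /predU1P[<-|/andP[_ /eqP qr]].
  by rewrite /identified pN pq eqxx orbT.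
by rewrite /identified pN pq qr eqxx orbT.
Qed.

Definition glue_rel := EquivRel _ glue_rel_refl glue_rel_sym glue_rel_trans.

Definition glued : topologicalType := quotient_topology {eq_quot glue_rel}.

End gluing.

(* s <> [::]: a gluing of zero copies is the empty space, on which the empty
   allocation is envy-free; connected spaces are nonempty by convention. *)
Definition tangle (R : realType) (T : topologicalType) : Prop :=
  connected [set: T] /\
  exists2 s : seq (nat * nat), s <> [::] & homeomorphic T (glued R s).

Definition interval_code : seq (nat * nat) := [:: (0, 1)]%N.
Definition circle_code : seq (nat * nat) := [:: (0, 0)]%N.
Definition lollipop_code : seq (nat * nat) := [:: (0, 0); (0, 1)]%N.
Definition figure8_code : seq (nat * nat) := [:: (0, 0); (0, 0)]%N.
Definition handcuffs_code : seq (nat * nat) := [:: (0, 0); (0, 1); (1, 1)]%N.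
Definition theta_code : seq (nat * nat) := [:: (0, 1); (0, 1); (0, 1)]%N.

Definition basic_stringable (R : realType) (T : topologicalType) : Prop :=
  exists2 s : seq (nat * nat),
    s \in [:: interval_code; circle_code; lollipop_code; figure8_code;
              handcuffs_code; theta_code] &
    homeomorphic T (glued R s).

Section points_and_edges.
Variables (R : realType) (T : topologicalType).

Definition half_open : topologicalType := set_type [set` `[0 : R, 1[].

Lemma half_open0_subproof : 0 \in [set` `[0 : R, 1[].
Proof. by apply/mem_set; rewrite /= in_itv /= lexx ltr01. Qed.

Definition half_open0 : half_open := exist _ 0 half_open0_subproof.

Definition star (k : nat) : topologicalType :=
  wedge (fun _ : 'I_k => half_open0).

Definition star_lift (k : nat) (i : 'I_k) : half_open -> star k :=
  @wedge_lift _ _ (fun _ : 'I_k => half_open0) i.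

Definition has_degree (x : T) (k : nat) : Prop :=
  exists2 U : set T, nbhs x U &
    exists2 f : star k -> set_type U, homeomorphism f &
      forall i : 'I_k, set_val (f (star_lift i half_open0)) = x.

Definition singular : set T :=
  [set x | has_degree x 1 \/ exists2 k, (3 <= k)%N & has_degree x k].

Definition edge (e : set T) : Prop :=
  exists2 x, (~` singular) x & e = connected_component (~` singular) x.

(* An edge is usually an open arc, so it is its closure that is parametrized
   by [0,1]. The values at 0 and 1 are allowed to coincide, which happens when
   the edge is a loop based at a singular point, or a whole circle. By
   compactness phi is automatically a homeomorphism from ]0,1[ onto its
   image. *)
Definition edge_identification (e : set T) (phi : R -> T) : Prop :=
  [/\ {within `[0, 1], continuous phi},
      {in `]0, 1[ &, injective phi},
      phi @` `]0, 1[ `<=` e &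
      phi @` `[0, 1] = closure e].

Definition edges_identification (m : nat) (phi : 'I_m -> R -> T) : Prop :=
  exists e : 'I_m -> set T,
    [/\ injective e, range e = [set E | edge E] &
        forall i, edge_identification (e i) (phi i)].

(* The set X(z), with z = (x_1,...,x_m; y_1,...,y_m): an interval with
   x_i > y_i is empty and contributes nothing. *)
Definition subtangle (m : nat) (phi : 'I_m -> R -> T)
    (z : 'rV[R]_m * 'rV[R]_m) : set T :=
  \bigcup_i (phi i @` (`[z.1 ord0 i, z.2 ord0 i] `&` `[0, 1])).

(* Only the values of nu on connected sets are meaningful. Continuity is
   required for every choice phi of identifications; off the circle, changing
   phi only reparametrizes z continuously. *)
Definition monotone_continuous (nu : set T -> R) : Prop :=
  [/\ forall X, connected X -> 0 <= nu X,
      nu set0 = 0,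
      forall X Y, connected X -> connected Y -> X `<=` Y -> nu X <= nu Y &
      forall (m : nat) (phi : 'I_m -> R -> T), edges_identification phi ->
        {within [set z | closed (subtangle phi z) /\
                         connected (subtangle phi z)],
          continuous (fun z => nu (subtangle phi z))}].

End points_and_edges.

Definition connected_allocation (T : topologicalType) (n : nat)
    (S : 'I_n -> set T) : Prop :=
  [/\ forall i, connected (S i), trivIset setT S & \bigcup_i S i = setT].

Definition envy_free (R : realType) (T : topologicalType) (n : nat)
    (nu : 'I_n -> set T -> R) (S : 'I_n -> set T) : Prop :=
  forall i j, nu i (S j) <= nu i (S i).

Definition guarantees_envy_free (R : realType) (T : topologicalType)
    (n : nat) : Prop :=
  forall nu : 'I_n -> set T -> R, (forall i, monotone_continuous (nu i)) ->
    exists2 S : 'I_n -> set T, connected_allocation S & envy_free nu S.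

(* Main.v *)
(* Let a tangle be glued from m copies of [0,1], and let V be the number of
   vertices at which at least two copy ends meet. If m >= V + 2 and n > V, give
   all agents the same additive valuation, namely length with total mass
   f = (V+1)/m < 1 on every copy but one, which gets mass n - V - 1 + f. The
   total mass is n, so with identical valuations all shares of an envy-free
   allocation have value at least 1. At most V shares contain a vertex; the
   other n - V or more lie each inside a single copy, which has to be the heavy
   one since f < 1, and are disjoint intervals there: this exceeds its mass
   n - V - 1 + f.
   A vertex where exactly two copy ends meet can be removed by merging the two
   copies (if they are one and the same copy, the tangle is a circle). In a code
   of minimal length this leaves V <= 2 and m <= 3 as soon as m <= V + 1, and an
   enumeration finds only the six basic stringable tangles. *)

Require Import Defs.
From mathcomp Require Import all_boot all_order all_algebra generic_quotient.
From mathcomp Require Import all_classical all_reals.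
From mathcomp Require Import topology normedtype.
From mathcomp Require Import measure lebesgue_measure measurable_realfun.
From mathcomp Require Import ring lra zify.
Import Order.TTheory GRing.Theory Num.Theory.
Import numFieldNormedType.Exports.

Set Implicit Arguments.
Unset Strict Implicit.
Unset Printing Implicit Defensive.

Local Open Scope classical_set_scope.
Local Open Scope ring_scope.

(** * Length within the unit interval *)

Section unit_length.
Variable R : realType.
Implicit Types A B : set R.

(* [lebesgue_measure] is defined on all sets, as an outer measure; additivity
   is used on intervals only. *)
Definition unit_length A : R := fine (lebesgue_measure (A `&` `[0, 1])).

Let mu_itv01 : (@lebesgue_measure R `[0%R, 1%R])%classic = 1%E.
Proof. by rewrite lebesgue_measure_itv/= lte_fin ltr01 oppr0 adde0. Qed.

Let le_mu A B : A `<=` B -> (@lebesgue_measure R A <= lebesgue_measure B)%E.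
Proof.
by move=> AB; rewrite /lebesgue_measure /lebesgue_stieltjes_measure;
  exact: le_outer_measure.
Qed.

Let muU A B :
  (@lebesgue_measure R (A `|` B) <= lebesgue_measure A + lebesgue_measure B)%E.
Proof.
by rewrite /lebesgue_measure /lebesgue_stieltjes_measure;
  exact: outer_measureU2.
Qed.

Lemma unit_lengthE A : (unit_length A)%:E = lebesgue_measure (A `&` `[0, 1]).
Proof.
rewrite fineK// ge0_fin_numE.
  by rewrite (@le_lt_trans _ _ 1%E)// ?ltry// -mu_itv01; exact: le_mu.
by rewrite -[leLHS](@measure0 _ _ _ (@lebesgue_measure R)); exact: le_mu.
Qed.

Lemma unit_length0 : unit_length set0 = 0.
Proof. by rewrite /unit_length set0I measure0. Qed.

(** Only the trace on [0,1] is measured, so an inclusion there suffices; outside [0,1] the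
    parametrizations [rho i] used later are mere constant extensions. *)
Lemma unit_lengthSI A B : A `&` `[0, 1] `<=` B -> unit_length A <= unit_length B.
Proof.
move=> AB; rewrite -lee_fin !unit_lengthE; apply: le_mu.
by move=> x [Ax x01]; split=> //; exact: AB.
Qed.

Lemma unit_lengthS A B : A `<=` B -> unit_length A <= unit_length B.
Proof. by move=> AB; apply: unit_lengthSI => x [] /AB. Qed.

Lemma unit_length_ge0 A : 0 <= unit_length A.
Proof. by rewrite -unit_length0 unit_lengthS. Qed.

Lemma unit_lengthT : unit_length setT = 1.
Proof. by rewrite /unit_length setTI mu_itv01. Qed.

Lemma unit_lengthU A B : unit_length (A `|` B) <= unit_length A + unit_length B.
Proof. by rewrite -lee_fin EFinD !unit_lengthE setIUl muU. Qed.

Lemma unit_length_ball (a e : R) : 0 <= e -> unit_length (ball a e) <= e *+ 2.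
Proof.
by move=> e0; rewrite -lee_fin unit_lengthE -(lebesgue_measure_ball a)// le_mu.
Qed.

(** Intervals are measurable, which gives additivity over the disjoint traces, and their union lies
    in [0,1], of measure 1. *)
Lemma sum_unit_length_itv n (P : {pred 'I_n}) (F : 'I_n -> set R) :
  (forall i, P i -> is_interval (F i `&` `[0, 1])) -> trivIset setT F ->
  \sum_(i < n | P i) unit_length (F i) <= 1.
Proof.
move=> itvF tF; rewrite -lee_fin -sumEFin.
under eq_bigr do rewrite unit_lengthE.
rewrite -measure_bigsetU_ord_cond.
- rewrite -[leRHS]mu_itv01; apply: le_mu.
  by rewrite -bigcup_seq_cond; apply: bigcup_sub => i _; exact: subIsetr.
- by move=> i Pi; apply: (@is_interval_measurable R); exact: itvF.
- by apply: trivIset_setIr; exact: sub_trivIset tF.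
Qed.

End unit_length.

(** * A continuity criterion for monotone subadditive set functions *)

Section monotone_continuity.
Variables (R : realType) (T : topologicalType) (nu : set T -> R).
Hypothesis nu0 : nu set0 = 0.
Hypothesis nuS : forall A B, A `<=` B -> nu A <= nu B.
Hypothesis nuU : forall A B, nu (A `|` B) <= nu A + nu B.
Hypothesis nu_small : forall (x : T) e, 0 < e -> exists2 U, nbhs x U & nu U < e.

Lemma nu_bigcup (m : nat) (F : 'I_m -> set T) :
  nu (\bigcup_i F i) <= \sum_(i < m) nu (F i).
Proof.
rewrite bigcup_mkcond; under eq_bigcupr => i _ do rewrite in_setT.
have -> : \bigcup_i F i = \big[setU/set0]_(i < m) F i.
  by rewrite -bigcup_seq; apply: eq_bigcupl => //; split=> i // _;
    rewrite /= mem_index_enum.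
elim/big_rec2: _ => [|i x X _ IH]; first by rewrite nu0.
by apply: le_trans (nuU _ _) _; rewrite lerD2l.
Qed.

(** The coordinates of [z] range over all reals, hence two cases: at a point [a] of [0,1] continuity
    of [phi] applies, and around any other [a] a small ball misses [0,1]. *)
Lemma nu_image_small (phi : R -> T) (a e : R) :
  {within `[0, 1], continuous phi} -> 0 < e ->
  exists2 d, 0 < d & nu (phi @` (ball a d `&` `[0, 1])) < e.
Proof.
move=> cphi e0; have [a01|aN01] := pselect (a \in `[0%R, 1%R]).
  have [U Ua Ue] := nu_small (phi a) e0.
  have /nbhs_ballP[d d0 dU] : nbhs a [set t | `[0, 1]%classic t -> U (phi t)].
    by move/subspace_continuousP : cphi => /(_ a a01 _ Ua).
  exists d => //; apply: le_lt_trans (nuS _) Ue.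
  by move=> _ [t [at_ t01] <-]; exact: (dU t).
have : nbhs a (~` [set` `[0%R, 1%R]]).
  apply: open_nbhs_nbhs; split => //.
  exact/closed_openC/itv_closed.
move=> /nbhs_ballP[d d0 dN]; exists d => //.
rewrite (_ : ball a d `&` _ = set0) ?image_set0 ?nu0//.
by apply/seteqP; split => // t [] /dN.
Qed.

(* The edges play no role: X(z) and X(z') differ only by images under the phi i
   of small intervals around the coordinates of z, hence by sets of small value. *)
Lemma small_nbhs_monotone_continuous : monotone_continuous nu.
Proof.
split=> [X _|//|X Y _ _|m phi [ed [_ _ edphi]]]; [|exact: nuS|].
  by rewrite -nu0 nuS.
apply: continuous_subspaceT => z; apply/cvgrPdist_lt => e e0.
(* Each of the [m] edges contributes two error sets of value below [e'], in total at most
   [m e / (m + 1) < e]; the added 1 also covers [m = 0]. *)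
pose e' := e / (m%:R + 1) / 2.
have m0 : 0 < m%:R + 1 :> R by rewrite ltr_wpDl.
have e'0 : 0 < e' by rewrite !divr_gt0.
have small (a : 'I_m -> R) : exists2 d, 0 < d &
    forall i, nu (phi i @` (ball (a i) d `&` `[0, 1])) < e'.
  have /choice[d dP] : forall i, exists d, 0 < d /\
      nu (phi i @` (ball (a i) d `&` `[0, 1])) < e'.
    move=> i; have [cphi _ _ _] := edphi i.
    by have [d d0 dP] := nu_image_small (a i) cphi e'0; exists d.
  have : \forall r \near 0^'+, forall i : 'I_m, (r : R) < d i.
    by apply: filter_forall => i; apply: nbhs_right_lt; case: (dP i).
  move=> near_d; have [r [r0 rd]] : exists r, 0 < r /\ forall i, r < d i.
    near (0 : R)^'+ => r; exists r; split; last by near: r.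
    by near: r; exact: nbhs_right_gt.
  exists r => // i; apply: le_lt_trans (dP i).2; apply: nuS.
  by apply: image_subset; apply: setSI; apply: le_ball; exact: ltW.
have [d1 d10 d1P] := small (z.1 ord0).
have [d2 d20 d2P] := small (z.2 ord0).
(* The disjunction lets one estimate serve in both directions. A parameter in the interval of [z1]
   but not in that of [z2] lies between two corresponding endpoints, one of which belongs to [z],
   hence in a small ball around a coordinate of [z]. *)
have close z1 z2 : (z1 = z \/ z2 = z) ->
    (forall i, `|z1.1 ord0 i - z2.1 ord0 i| < d1) ->
    (forall i, `|z1.2 ord0 i - z2.2 ord0 i| < d2) ->
    nu (subtangle phi z1) - nu (subtangle phi z2) < e.
  move=> z12 zd1 zd2.
  pose bd i := phi i @` (ball (z.1 ord0 i) d1 `&` `[0, 1]) `|`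
               phi i @` (ball (z.2 ord0 i) d2 `&` `[0, 1]).
  have : subtangle phi z1 `<=` subtangle phi z2 `|` \bigcup_i bd i.
    move=> _ [i _ [t [t1 t01] <-]].
    have [t2|/negP] := boolP (t \in `[z2.1 ord0 i, z2.2 ord0 i]).
      by left; exists i => //; exists t.
    have zi1 := zd1 i; have zi2 := zd2 i.
    move: t1; rewrite /= !in_itv/= => /andP[t1 t1'] /negP.
    rewrite negb_and -!ltNge => t2; right; exists i => //.
    case/orP: t2 => t2; [left|right]; exists t => //; split => //=;
      rewrite /ball/=; case: z12 => <-; move: zi1 zi2;
      rewrite !ltr_norml => /andP[? ?] /andP[? ?]; apply/andP; split; lra.
  move=> /nuS /le_trans -/(_ _ (nuU _ _)) h.
  rewrite ltrBlDl (le_lt_trans h)// ltrD2l (le_lt_trans (nu_bigcup _))//.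
  apply: (@le_lt_trans _ _ (\sum_(i < m) (e' + e'))).
    apply: ler_sum => i _; apply: le_trans (nuU _ _) _.
    by rewrite lerD// ltW.
  rewrite sumr_const card_ord -mulr_natl /e' -splitr mulrC -mulrA.
  by rewrite gtr_pMr// mulrC ltr_pdivrMr// mul1r ltrDl.
have coordC (p : 'rV[R]_m * 'rV[R]_m -> 'rV[R]_m) (d : R) : 0 < d -> continuous p ->
    \forall z' \near z, forall i, `|p z ord0 i - p z' ord0 i| < d.
  move=> d0 cp.
  suff H i : \forall z' \near z, `|p z ord0 i - p z' ord0 i| < d.
    exact: (filter_forall _ H).
  have : (fun z' => p z' ord0 i) @ z --> p z ord0 i.
    apply: (@continuous_comp _ _ _ p (fun M : 'rV_m => M ord0 i)); first exact: cp.
    exact: (@coord_continuous R 1 m ord0 i (p z)).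
  by move=> /cvgrPdist_lt; apply.
near=> z'.
have dz1 : forall i, `|z.1 ord0 i - z'.1 ord0 i| < d1.
  by near: z'; apply: (coordC fst d1 d10) => ?; exact: cvg_fst.
have dz2 : forall i, `|z.2 ord0 i - z'.2 ord0 i| < d2.
  by near: z'; apply: (coordC snd d2 d20) => ?; exact: cvg_snd.
rewrite ltr_norml ltrNl opprB; apply/andP; split; apply: close; auto;
  by move=> i; rewrite distrC.
Unshelve. all: by end_near.
Qed.

End monotone_continuity.

(** * Retraction of the line onto the unit interval *)

Section clamp.
Variable R : realType.
Implicit Type t : R.

Definition clamp t : R := Num.max 0 (Num.min 1 t).

Lemma clamp_itv t : 0 <= clamp t <= 1.
Proof. by rewrite /clamp le_max lexx ge_max ler01 ge_min lexx. Qed.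

Lemma clamp_id t : 0 <= t <= 1 -> clamp t = t.
Proof. by case/andP=> t0 t1; rewrite /clamp min_r// max_r. Qed.

Lemma clamp_continuous : continuous clamp.
Proof.
move=> t; apply: (@continuous_max R R (fun=> 0) (fun u => Num.min 1 u)).
  exact: cst_continuous.
apply: (@continuous_min R R (fun=> 1) idfun); first exact: cst_continuous.
by move=> A; apply.
Qed.

End clamp.

(** * Gluings as quotient maps from intervals extended to the line *)

Section coding.
Variables (R : realType) (T : topologicalType).
Implicit Types (s : seq (nat * nat)) (t u : R) (rho : nat -> R -> T).

Definition end_lab s (i : nat) (b : bool) : nat :=
  let ends := nth (0, 0)%N s i in if b then ends.2 else ends.1.

Definition lab s (i : nat) t : option nat :=
  if t == 0 then Some (end_lab s i false)
  else if t == 1 then Some (end_lab s i true) else None.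

(* [rho i] is the [i]-th copy of [0,1], extended to all of R by constants so
   that no subtype is involved. *)
Record coding s rho : Prop := Coding {
  coding_open : forall U : set T,
    open U <-> forall i, (i < size s)%N -> open (rho i @^-1` U);
  coding_clamp : forall i t, rho i t = rho i (clamp t);
  coding_eq : forall i j t u, (i < size s)%N -> (j < size s)%N ->
    0 <= t <= 1 -> 0 <= u <= 1 -> rho i t = rho j u <->
    (i = j /\ t = u) \/ (lab s i t != None /\ lab s i t = lab s j u);
  coding_surj : forall x, exists i t,
    [/\ (i < size s)%N, 0 <= t <= 1 & rho i t = x] }.

Local Notation pi s := (\pi_({eq_quot (glue_rel R s)})%qT : copies R s -> glued R s).

Definition copies_pt s (i : 'I_(size s)) t : copies R s :=
  existT _ i (exist _ (clamp t) (mem_set (clamp_itv t : `[0, 1]%classic (clamp t)))).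

Lemma copies_pt_id s (i : 'I_(size s)) (x : set_type [set` `[0 : R, 1]]) :
  copies_pt i (set_val x) = existT _ i x.
Proof.
case: x => t t01; congr existT; apply: val_inj; rewrite /= clamp_id//.
by have := set_mem t01; rewrite /= in_itv.
Qed.

Lemma tagged_copies_pt s (i : 'I_(size s)) t : 0 <= t <= 1 ->
  set_val (tagged (copies_pt i t)) = t.
Proof. exact: clamp_id. Qed.

Lemma copies_ptP s (p : copies R s) :
  exists i t, 0 <= t <= 1 /\ p = copies_pt i t.
Proof.
case: p => i x; exists i, (set_val x); rewrite copies_pt_id; split=> //.
by case: x => t t01; have := set_mem t01; rewrite /= in_itv.
Qed.

(** Since [clamp] is a continuous retraction onto [0,1], being open in a copy amounts to having an
    open pullback to the whole line. *)
Lemma copies_openP s (V : set (copies R s)) :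
  open V <-> forall i, open (copies_pt i @^-1` V).
Proof.
split=> [oV i|oV].
  have [W oW WV] := (sigT_openP V).1 oV i.
  rewrite (_ : _ @^-1` V = @clamp R @^-1` W).
    by move/continuousP : (@clamp_continuous R); apply.
  apply/seteqP; split=> t; pose x : set_type [set` `[0 : R, 1]] :=
    exist _ (clamp t) (mem_set (clamp_itv t : `[0, 1]%classic (clamp t)));
    by rewrite -[(@clamp R @^-1` W) t]/((set_val @^-1` W) x) WV.
apply/sigT_openP => i; exists (copies_pt i @^-1` V); first exact: oV.
by apply/seteqP; split => x /=; rewrite copies_pt_id.
Qed.

Lemma pi_eq s i j t u : 0 <= t <= 1 -> 0 <= u <= 1 ->
  pi s (copies_pt i t) = pi s (copies_pt j u) <->
  ((i = j :> nat) /\ t = u) \/ (lab s i t != None /\ lab s i t = lab s j u).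
Proof.
move=> t01 u01; pose p := copies_pt i t; pose q := copies_pt j u.
transitivity (identified p q).
  by split=> [/(@eqmodP _ (glue_rel R s))//|]; move/(@eqmodP _ (glue_rel R s)).
rewrite /identified {}/p {}/q.
have E (k : 'I_(size s)) (v : R) : 0 <= v <= 1 -> end_label (copies_pt k v) = lab s k v.
  by move=> v01; rewrite /end_label /lab tagged_copies_pt.
rewrite !E//; split.
  case/predU1P => [|/andP[? /eqP ?]]; last by right.
  move=> pq; left; split; first by have := congr1 (fun p : copies R s => val (tag p)) pq.
  have := congr1 (fun p : copies R s => set_val (tagged p)) pq.
  by rewrite !tagged_copies_pt.
case=> [[ij ->]|[-> /eqP ->]]; last by rewrite orbT.
by rewrite (ord_inj ij) eqxx.
Qed.

(** A coding is a quotient map from the disjoint union of the copies onto [T] whose fibres are the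
    gluing classes, and two quotient maps with the same fibres have homeomorphic targets. *)
Lemma homeomorphic_coding s : s <> [::] ->
  homeomorphic T (glued R s) <-> exists rho, coding s rho.
Proof.
move=> s0; have s_gt0 : (0 < size s)%N by case: s s0.
split=> [[h [ch [g [hK gK cg]]]]|[rho crho]].
  (* [rho] is indexed by all natural numbers; indices past the code fall back to copy 0, which
     exists since [s] is nonempty. *)
  pose ord i : 'I_(size s) := insubd (Ordinal s_gt0) i.
  have ordE i : (i < size s)%N -> ord i = i :> nat by move=> ?; rewrite /ord val_insubd ifT.
  have oE i : ord (val i) = i by rewrite /ord valKd.
  exists (fun i t => g (pi s (copies_pt (ord i) t))); split.
  - move=> U; transitivity (open (g @^-1` U)).
      split=> [oU|]; first by move/continuousP : cg; exact.
      move=> oU; rewrite (_ : U = h @^-1` (g @^-1` U)); last first.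
        by apply/seteqP; split=> x /=; rewrite hK.
      by move/continuousP : ch; apply.
    rewrite -[open (g @^-1` U)]/(open (pi s @^-1` (g @^-1` U))) copies_openP.
    split=> [oU i _|oU i]; first exact: oU.
    by have := oU i (ltn_ord i); rewrite oE.
  - by move=> i t; rewrite /copies_pt; congr (g (pi s (existT _ _ _)));
      apply: val_inj; rewrite /= [in RHS]clamp_id ?clamp_itv.
  - move=> i j t u im jm t01 u01.
    by rewrite (rwP eqP) (can_eq gK) -(rwP eqP) pi_eq// !ordE.
  - move=> x; have [i [t [t01 E]]] := copies_ptP (repr (h x)).
    by exists i, t; split; rewrite ?oE -?E ?reprK ?hK.
pose q (p : copies R s) := rho (tag p) (set_val (tagged p)).
have qE i t : q (copies_pt i t) = rho i t by rewrite /q/= -(coding_clamp crho).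
have qpi p p' : q p = q p' <-> pi s p = pi s p'.
  have [i [t [t01 ->]]] := copies_ptP p; have [j [u [u01 ->]]] := copies_ptP p'.
  by rewrite !qE pi_eq// (coding_eq crho).
have qsurj x : exists p, q p = x.
  have [i [t [im t01 <-]]] := coding_surj crho x.
  by exists (copies_pt (Ordinal im) t); rewrite qE.
have qopen (U : set T) : open U <-> open (q @^-1` U).
  rewrite copies_openP (coding_open crho); split=> H i.
    by have := H i (ltn_ord i); congr open; apply/funext => t /=; rewrite qE.
  by move=> im; have := H (Ordinal im); congr open; apply/funext => t /=; rewrite qE.
have [f fE] := choice qsurj.
(* As [q] and [pi s] have the same fibres, a point goes to the class of any of its preimages, and a
   class to the image of any representative. *)
exists (fun x => pi s (f x)); split; last exists (fun y => q (repr y)).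
  apply/continuousP => V oV; apply/qopen.
  rewrite (_ : _ @^-1` _ = pi s @^-1` V)//.
  by apply/seteqP; split=> p /=; rewrite (_ : pi s (f (q p)) = pi s p)//; apply/qpi.
have rK p : q (repr (pi s p)) = q p by apply/qpi; rewrite reprK.
split=> [x|y|]; first by rewrite rK fE.
  by rewrite -[RHS]reprK; apply/qpi; rewrite fE.
apply/continuousP => U /qopen oU.
rewrite -[open _]/(open (pi s @^-1` ((fun y => q (repr y)) @^-1` U))).
by congr open: oU; apply/seteqP; split=> p /=; rewrite rK.
Qed.

End coding.

(** * Labels and their multiplicities *)

Definition labels (s : seq (nat * nat)) : seq nat :=
  flatten [seq [:: p.1; p.2] | p <- s].

(* A branch label may belong to a point of degree 2 of the tangle, which is not
   singular: what is counted are the copies of the code, not the edges. *)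
Definition branch s := [seq l <- undup (labels s) | (1 < count_mem l (labels s))%N].

Lemma size_labels s : size (labels s) = (size s).*2.
Proof. by elim: s => //= p s ->. Qed.

Lemma nth_labels s i (b : bool) : nth 0%N (labels s) (i.*2 + b) = end_lab s i b.
Proof.
elim: s i => [|p s IH] [|i] /=; rewrite /end_lab.
- by case: (b).
- by rewrite !nth_nil; case: (b).
- by case: (b).
- exact: IH.
Qed.

Lemma mem_end_lab s i (b : bool) : (i < size s)%N -> end_lab s i b \in labels s.
Proof.
by move=> im; rewrite -nth_labels mem_nth// size_labels; case: b; lia.
Qed.

(** One occurrence lies before position [q], another from [q] on. *)
Lemma count_mem_nth_neq (l : seq nat) p q :
  (p < q < size l)%N -> nth 0%N l p = nth 0%N l q ->
  (1 < count_mem (nth 0%N l p) l)%N.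
Proof.
move=> /andP[pq ql] E; rewrite -{2}(cat_take_drop q l) count_cat.
rewrite -[2%N]/(1 + 1)%N leq_add// -has_count has_pred1.
  by rewrite -(nth_take 0%N pq) mem_nth// size_take ql.
by rewrite E -[q in nth _ _ q]addn0 -nth_drop mem_nth// size_drop subn_gt0.
Qed.

Lemma mem_branch_end_lab s i j (b c : bool) : (i < size s)%N -> (j < size s)%N ->
  (i, b) <> (j, c) -> end_lab s i b = end_lab s j c -> end_lab s i b \in branch s.
Proof.
move=> im jm ne; rewrite mem_filter mem_undup -!nth_labels => E.
have bd k (d : bool) : (k < size s)%N -> (k.*2 + d < size (labels s))%N.
  by rewrite size_labels; case: d; lia.
rewrite mem_nth ?bd// andbT.
have [lt|lt|eq] := ltngtP (i.*2 + b)%N (j.*2 + c)%N.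
- by apply: (count_mem_nth_neq _ E); rewrite lt bd.
- by rewrite E; apply: (count_mem_nth_neq _ (esym E)); rewrite lt bd.
- by exfalso; apply: ne; case: (b) (c) eq => -[]/= ?; congr (_, _); lia.
Qed.

(** Within [S], the trace of [A] is open, and it is closed as the complement of the trace of [B];
    being nonempty, it is all of [S]. *)
Lemma connected_sub_open (T : topologicalType) (S A B : set T) :
  connected S -> open A -> open B ->
  A `&` B = set0 -> S `<=` A `|` B -> S `&` A !=set0 -> S `<=` A.
Proof.
move=> cS oA oB AB SAB SA0; suff <- : S `&` A = S; first exact: subIsetr.
apply: cS => //; first by exists A.
exists (~` B); first exact: open_closedC.
apply/seteqP; split=> x [Sx].
  by move=> Ax; split=> // Bx; have : (A `&` B) x by []; rewrite AB.
by have [|//] := SAB x Sx.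
Qed.

(** * Open arcs and weighted length on a coded tangle *)

Section valuation.
Variables (R : realType) (T : topologicalType).
Variables (s : seq (nat * nat)) (rho : nat -> R -> T).
Hypothesis crho : coding s rho.
Implicit Types (t u : R) (S : set T) (O : set R).

Lemma lab_some i t l : lab s i t = Some l ->
  exists b : bool, t = b%:R /\ end_lab s i b = l.
Proof.
rewrite /lab; case: eqP => [->|_]; first by case=> <-; exists false.
by case: eqP => [->|//]; case=> <-; exists true.
Qed.

(** Ends whose label occurs only once remain: they are free ends of the tangle, and no other
    parameter is mapped to them. *)
Definition regular i := [set t : R | 0 <= t <= 1 /\
  forall l, l \in branch s -> lab s i t <> Some l].

Definition open_arc i O := rho i @` (regular i `&` O).

(** A label shared by two different copy ends is a branch label, which regularity excludes. *)
Lemma regular_inj i j t u : (i < size s)%N -> (j < size s)%N ->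
  regular i t -> 0 <= u <= 1 -> rho i t = rho j u -> i = j /\ t = u.
Proof.
move=> im jm [t01 reg] u01 /(coding_eq crho im jm t01 u01)[//|[]].
have [tu|ne] := pselect ((i, t) = (j, u)); first by case: tu.
case E : (lab s i t) => [l|//] _ /esym E'; exfalso.
have [b [tb lb]] := lab_some E; have [c [uc lc]] := lab_some E'.
apply: reg E; rewrite -lb; apply: (mem_branch_end_lab im jm (c := c)); last by rewrite lc.
by move=> [ij bc]; apply: ne; rewrite ij tb uc bc.
Qed.

(** In copy [i] the pullback comes, through [clamp], from [O] minus the branch ends, a closed set
    with at most two points; in any other copy it is empty. *)
Lemma open_arc_open i O : (i < size s)%N -> open O -> open (open_arc i O).
Proof.
move=> im oO; apply/(coding_open crho) => j jm.
have [<-{j jm}|/eqP ij] := eqVneq i j; last first.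
  rewrite (_ : _ @^-1` _ = set0); first exact: open0.
  apply/seteqP; split=> // u -[t [reg _]]; rewrite (coding_clamp crho j).
  by move=> /(regular_inj im jm reg (clamp_itv u))[].
pose F := [set t : R | exists l, l \in branch s /\ lab s i t = Some l].
have clF : closed F.
  suff -> : F = [set t | t = 0 /\ end_lab s i false \in branch s] `|`
                [set t | t = 1 /\ end_lab s i true \in branch s].
    have cl1 (x : R) (P : Prop) : closed [set t | t = x /\ P].
      have [p|np] := pselect P.
        rewrite (_ : mkset _ = [set x]); first exact: closed_eq.
        by apply/seteqP; split=> t /= => [[]|->].
      rewrite (_ : mkset _ = set0); first exact: closed0.
      by apply/seteqP; split=> t /= => [[]|].
    by apply: closedU; exact: cl1.
  apply/seteqP; split=> t /=.
    by case=> l [lB /lab_some[[] [-> E]]]; rewrite -E in lB; [right|left].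
  by case=> -[tE lB]; eexists; (split; first exact: lB); rewrite /lab tE ?oner_eq0 ?eqxx.
rewrite (_ : _ @^-1` _ = @clamp R @^-1` (O `\` F)).
  move/continuousP : (@clamp_continuous R); apply.
  by apply: openI => //; exact: closed_openC.
apply/seteqP; split=> u; rewrite /= (coding_clamp crho).
  move=> [t [reg Ot]] /(regular_inj im im reg (clamp_itv u))[_ <-]; split=> //.
  by move=> [l [lB]]; case: reg => _ /(_ _ lB).
move=> [Ou nF]; exists (clamp u) => //; split=> //; split; first exact: clamp_itv.
by move=> l lB E; apply: nF; exists l.
Qed.

Lemma disjoint_arc i j O O' : (i < size s)%N -> (j < size s)%N ->
  i <> j \/ O `&` O' = set0 -> open_arc i O `&` open_arc j O' = set0.
Proof.
move=> im jm OO'; apply/seteqP; split=> // _ [[t [rt Ot] <-] [u [ru Ou]]] /esym.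
move=> /(regular_inj im jm rt ru.1)[ij tu]; case: OO' => [//|OO'].
have : (O `&` O') u by split; rewrite // -tu.
by rewrite OO'.
Qed.

(** Away from the branch points the space is a disjoint union of open arcs, so a connected set
    avoiding them stays in one. *)
Lemma connected_sub_arc S : connected S -> S !=set0 ->
  (forall i t l, (i < size s)%N -> 0 <= t <= 1 -> l \in branch s ->
    lab s i t = Some l -> ~ S (rho i t)) ->
  exists2 i, (i < size s)%N & S `<=` open_arc i setT.
Proof.
move=> cS [x Sx] nb.
have reg j u : (j < size s)%N -> 0 <= u <= 1 -> S (rho j u) -> regular j u.
  by move=> jm u01 Su; split=> // l lB E; exact: (nb j u l).
have [i [t [im t01 xE]]] := coding_surj crho x.
exists i => //.
pose others := [set j | (j < size s)%N /\ j <> i].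
apply: (@connected_sub_open _ _ _ (\bigcup_(j in others) open_arc j setT)) => //.
- exact/open_arc_open/openT.
- by apply: bigcup_open => j [jm _]; exact/open_arc_open/openT.
- apply/seteqP; split=> // y [Ay [j [jm ji] By]].
  by have : (open_arc i setT `&` open_arc j setT) y by []; rewrite disjoint_arc//; left=> /esym.
- move=> y Sy; have [j [u [jm u01 yE]]] := coding_surj crho y.
  have [ji|/eqP ji] := eqVneq j i; [left|right; exists j => //].
    by rewrite -ji; exists u => //; split=> //; apply: reg; rewrite ?yE.
  by exists u => //; split=> //; apply: reg; rewrite ?yE.
- by exists x; split=> //; exists t => //; split=> //; apply: reg; rewrite ?xE.
Qed.

(** A parameter [z] missing between two present ones would split [S] between the open arcs of
    parameters below and above [z]. *)
Lemma arc_interval i S : (i < size s)%N -> connected S -> S `<=` open_arc i setT ->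
  is_interval (rho i @^-1` S `&` `[0, 1]).
Proof.
move=> im cS Sarc x y [/= Sx]; rewrite in_itv => /= x01 [/= Sy]; rewrite in_itv/= => y01.
move=> z /andP[xz zy]; have z01 : 0 <= z <= 1 by lra.
have reg u : 0 <= u <= 1 -> S (rho i u) -> regular i u.
  move=> u01 Su; have [t [rt _] tu] := Sarc _ Su.
  by have [_ <-] := regular_inj im im rt u01 tu.
split; rewrite /= ?in_itv//; apply: contrapT => nSz.
have ne u : S (rho i u) -> u <> z by move=> + E; rewrite E.
have [xz'|] := ltrP x z; last by move=> zx; apply: (ne x) => //; lra.
have [zy'|] := ltrP z y; last by move=> yz; apply: (ne y) => //; lra.
have : S `<=` open_arc i [set` `]-oo, z[].
  apply: (@connected_sub_open _ _ _ (open_arc i [set` `]z, +oo[])) => //.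
  - exact: open_arc_open.
  - exact: open_arc_open.
  - apply: disjoint_arc => //; right; apply/seteqP; split=> // u [] /=.
    by rewrite !in_itv/= andbT; lra.
  - move=> w Sw; have [u [ru _] uw] := Sarc _ Sw.
    have := ne u; rewrite uw => /(_ Sw)/eqP; rewrite neq_lt => /orP[uz|zu];
      [left|right]; exists u => //; split=> //=; by rewrite in_itv/= ?andbT.
  - by exists (rho i x); split=> //; exists x => //; split; [exact: reg|rewrite /= in_itv].
move=> /(_ _ Sy)[u [ru]]; rewrite /= in_itv/= => uz /(regular_inj im im ru y01)[_ uy].
by move: zy'; rewrite -uy; lra.
Qed.

Section weights.
Variable w : nat -> R.
Hypothesis w_ge0 : forall i, 0 <= w i.

Definition valuation S : R :=
  \sum_(i < size s) w i * unit_length (rho i @^-1` S).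

Lemma valuation0 : valuation set0 = 0.
Proof. by apply: big1 => i _; rewrite preimage_set0 unit_length0 mulr0. Qed.

Lemma valuationS A B : A `<=` B -> valuation A <= valuation B.
Proof.
move=> AB; apply: ler_sum => i _; rewrite ler_wpM2l//; apply: unit_lengthS.
by move=> t /AB.
Qed.

Lemma valuationU A B : valuation (A `|` B) <= valuation A + valuation B.
Proof.
rewrite -big_split /=; apply: ler_sum => i _.
by rewrite -mulrDr ler_wpM2l// preimage_setU unit_lengthU.
Qed.

Lemma valuationT : valuation setT = \sum_(i < size s) w i.
Proof. by apply: eq_bigr => i _; rewrite preimage_setT unit_lengthT mulr1. Qed.

Lemma valuation_small (x : T) e : 0 < e -> exists2 U, nbhs x U & valuation U < e.
Proof.
move=> e0; have [i0 [t0 [i0m t001 xE]]] := coding_surj crho x.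
pose W := \sum_(i < size s) w i.
have W0 : 0 <= W by exact: sumr_ge0.
(* The bound 1/2 makes two ends at distance below [d] equal; for [t0] inside the copy, the third
   condition keeps both ends out of the ball around [t0]; the factor 6 stands for three balls of
   length [2d] in each copy. *)
have [d [d0 d12 dt0 dW]] : exists d : R, [/\ 0 < d, d <= 1 / 2,
    0 < t0 < 1 -> d <= t0 /\ d <= 1 - t0 & W * (d *+ 6) < e].
  (* [W + 1] instead of [W], since all weights may vanish. *)
  have d10 : 0 < e / ((W + 1) * 6) by rewrite divr_gt0// mulr_gt0// ltr_wpDl.
  pose m := if 0 < t0 < 1 then Num.min t0 (1 - t0) else 1.
  have m0 : 0 < m by rewrite /m; case: ifP => // /andP[? ?]; rewrite lt_min subr_gt0; apply/andP.
  exists (Num.min (e / ((W + 1) * 6)) (Num.min (1 / 2) m)); split.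
  - by rewrite !lt_min d10 m0 divr_gt0.
  - by rewrite !ge_min lexx orbT.
  - by move=> t0b; rewrite /m t0b !ge_min !lexx ?orbT.
  - apply: (@le_lt_trans _ _ (W * (e / ((W + 1) * 6) *+ 6))).
      by rewrite ler_wpM2l// lerMn2r/= ge_min lexx.
    have -> : W * (e / ((W + 1) * 6) *+ 6) = W * e / (W + 1).
      by field; rewrite gt_eqF// ltr_wpDl.
    rewrite ltr_pdivrMr ?ltr_wpDl//.
    by rewrite mulrDr mulr1 mulrC ltrDl.
(* By the choice of [d], a copy end within [d] of a preimage of [x] is itself a
   preimage of [x], so that [U] pulls back to balls around these preimages. *)
pose near j := [set u : R | 0 <= u <= 1 /\ rho j u = x].
pose U := [set y | exists j t u,
  [/\ (j < size s)%N, 0 <= t <= 1, rho j t = y, near j u & `|t - u| < d]].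
have pre j : (j < size s)%N ->
    rho j @^-1` U = @clamp R @^-1` (\bigcup_(u in near j) ball u d).
  move=> jm; apply/seteqP; split=> v /=; last first.
    move=> [u un]; rewrite /ball/= => uv; exists j, (clamp v), u; split=> //.
    - exact: clamp_itv.
    - by rewrite -(coding_clamp crho).
    - by rewrite distrC.
  move=> [k [t [u [km t01 + un tu]]]]; rewrite (coding_clamp crho j v) => /esym E.
  have v01 := clamp_itv v.
  case: ((coding_eq crho jm km v01 t01).1 E) => [[jk vt]|[labN labE]].
    by exists u; rewrite ?jk// /ball/= distrC vt.
  have [l tl] : exists l, lab s k t = Some l.
    by rewrite -labE; case: (lab s j _) labN => // l; exists l.
  have t01b : t = 0 \/ t = 1 by have [[] [-> _]] := lab_some tl; auto.
  suff tu' : t = u by exists (clamp v); [by split=> //; rewrite E tu'; case: un|exact: ballxx].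
  have [u01 ux] := un.
  have ub : u = 0 \/ u = 1 -> t = u.
    by move: tu; rewrite ltr_norml => /andP[? ?] [] ?; case: t01b => ?; lra.
  have : rho k u = rho i0 t0 by rewrite ux.
  case/(coding_eq crho km i0m u01 t001) => [[_ ut]|[]]; last first.
    by case E2 : (lab s k u) => [l'|//] _ _; have [[] [? _]] := lab_some E2; apply: ub; auto.
  have [t0b|nt0b] := boolP (0 < t0 < 1); last first.
    by apply: ub; move: nt0b; rewrite ut; move: t001; rewrite !le_eqVlt;
      case/andP=> /predU1P[<-|->] /predU1P[->|->]; auto.
  have [? ?] := dt0 t0b.
  by move: tu; rewrite ut ltr_norml => /andP[? ?]; case: t01b => ?; lra.
exists U.
  apply: open_nbhs_nbhs; split.
    apply/(coding_open crho) => j jm; rewrite pre//.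
    move/continuousP : (@clamp_continuous R); apply.
    by apply: bigcup_open => u _; exact: ball_open.
  by exists i0, t0, t0; split=> //; rewrite subrr normr0.
apply: le_lt_trans dW; rewrite /W big_distrl/=; apply: ler_sum => j _.
rewrite ler_wpM2l//.
(* The preimages of [x] in copy [j] are ends or the parameter [t0]. *)
suff : unit_length (rho j @^-1` U) <= unit_length (ball (0 : R) d `|` ball (1 : R) d `|` ball t0 d).
  move=> /le_trans; apply.
  have -> : d *+ 6 = d *+ 2 + d *+ 2 + d *+ 2 by rewrite -!mulrnDr.
  apply: le_trans (unit_lengthU _ _) _; apply: lerD; last exact/unit_length_ball/ltW.
  apply: le_trans (unit_lengthU _ _) _.
  by apply: lerD; exact/unit_length_ball/ltW.
apply: unit_lengthSI => t [] /[swap]; rewrite /= in_itv/= => t01.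
rewrite -[U _]/((rho j @^-1` U) t) pre//= clamp_id// => -[u [u01 ux] ut].
have : rho j u = rho i0 t0 by rewrite ux.
case/(coding_eq crho (ltn_ord j) i0m u01 t001) => [[_ ut']|[]].
  by right; rewrite -ut'.
by case E : (lab s j u) => [l|//] _ _; have [[] [u1 _]] := lab_some E; left;
  [right|left]; rewrite u1 in ut.
Qed.

Lemma valuation_monotone_continuous : monotone_continuous valuation.
Proof.
apply: small_nbhs_monotone_continuous.
- exact: valuation0.
- exact: valuationS.
- exact: valuationU.
- exact: valuation_small.
Qed.

Lemma valuation_arc i S : (i < size s)%N -> S `<=` open_arc i setT ->
  valuation S = w i * unit_length (rho i @^-1` S).
Proof.
move=> im Sarc; rewrite /valuation (bigD1 (Ordinal im))//= big1 ?addr0// => j ji.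
rewrite (_ : unit_length _ = 0) ?mulr0//; apply: le_anti; rewrite unit_length_ge0 andbT.
rewrite -(unit_length0 R) unit_lengthSI// => t [/= /Sarc [u [ru _] uE]]; rewrite in_itv/= => t01.
have [ij _] := regular_inj im (ltn_ord j) ru t01 uE.
by case/eqP: ji; apply: val_inj.
Qed.

End weights.

End valuation.

(** * The counting argument *)

Lemma coding_not_guarantees (R : realType) (T : topologicalType)
    (s : seq (nat * nat)) (rho : nat -> R -> T) (n : nat) :
  coding s rho -> ((size (branch s)).+2 <= size s)%N -> (size (branch s) < n)%N ->
  ~ guarantees_envy_free R T n.
Proof.
move=> crho; set V := size (branch s) => Vm Vn guar.
have m0 : (0 < size s)%N by exact: leq_trans Vm.
have mR : 0 < (size s)%:R :> R by rewrite ltr0n.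
pose f : R := V.+1%:R / (size s)%:R.
have f0 : 0 <= f by exact: divr_ge0.
have f1 : f < 1 by rewrite ltr_pdivrMr// mul1r ltr_nat.
(* Copy 0 is the heavy one. The weights add up to [(V + 1) + (n - V - 1) = n], the truncated
   subtraction being exact because [V < n]. *)
pose w i : R := f + (if i == 0%N then (n - V.+1)%:R else 0).
have w0 i : 0 <= w i by rewrite addr_ge0//; case: ifP.
have sumw : \sum_(i < size s) w i = n%:R.
  rewrite big_split/= sumr_const card_ord -[f *+ _]mulr_natr /f divfK ?gt_eqF//.
  rewrite (bigD1 (Ordinal m0))//= big1 ?addr0 -?natrD ?subnKC// => i.
  by rewrite -val_eqE /= => /negPf ->.
have [S [cS tS covS] ef] := guar (fun=> valuation s rho w)
  (fun=> valuation_monotone_continuous crho w0).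
pose nu := valuation s rho w.
have n0 : (0 < n)%N by exact: leq_ltn_trans Vn.
have nuE j : nu (S j) = nu (S (Ordinal n0)) by apply: le_anti; rewrite !ef.
(* All shares have the same value, and by subadditivity [n] times this value is at least [n]. *)
have v1 : 1 <= nu (S (Ordinal n0)).
  have := nu_bigcup (valuation0 s rho w) (@valuationU _ _ s rho _ w0) S.
  rewrite covS valuationT sumw (eq_bigr (fun=> nu (S (Ordinal n0)))); last by move=> j _; exact: nuE.
  by rewrite sumr_const card_ord -[leRHS]mulr_natr -[leLHS]mul1r ler_pM2r ?ltr0n.
pose at_branch j l := l \in branch s /\ exists i t,
  [/\ (i < size s)%N, 0 <= t <= 1, lab s i t = Some l & S j (rho i t)].
pose bad := [pred j : 'I_n | `[< exists l, at_branch j l >]].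
(* Each bad share picks one of its branch labels, any other share a dummy 0. All copy ends with a
   given label are one point, so disjoint bad shares pick different labels. *)
have /choice[b bP] : forall j, exists l, j \in bad -> at_branch j l.
  move=> j; have [jb|jN] := boolP (j \in bad); last by exists 0%N.
  by move: jb; rewrite inE => -[l jl]; exists l.
have card_bad : (#|bad| <= V)%N.
  rewrite cardE -(size_map b); apply: uniq_leq_size; last first.
    by move=> _ /mapP[j + ->]; rewrite mem_enum => /bP[].
  rewrite map_inj_in_uniq ?enum_uniq// => j k; rewrite !mem_enum.
  move=> /bP[_ [i [t [im t01 it Sj]]]] /bP[_ [i' [t' [im' t01' it' Sk]]]] bjk.
  apply: tS => //; exists (rho i t); split=> //.
  suff -> : rho i t = rho i' t' by [].
  by apply/(coding_eq crho) => //; right; rewrite it it' bjk.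
have good_arc j : j \notin bad -> S j `<=` open_arc s rho 0 setT.
  move=> jN; have Sj0 : S j !=set0.
    apply/set0P/eqP => Sj; move: v1; rewrite -(nuE j) Sj /nu valuation0.
    by rewrite ler10.
  have [i t l im t01 lB it Sjt|i im Sarc] := connected_sub_arc crho (cS j) Sj0.
    move/negP : jN; apply; rewrite inE.
    by exists l; split=> //; exists i, t.
  have [i0|i0] := eqVneq i 0%N; first by rewrite -i0.
  (* A light copy has total mass [f < 1], too little for a share. *)
  move: v1; rewrite -(nuE j) /nu (valuation_arc crho w im Sarc) leNgt.
  rewrite /w (negPf i0) addr0 (le_lt_trans _ f1)// ler_piMr//.
  by rewrite -[leRHS](unit_lengthT R) unit_lengthS.
(* Each good share is worth at least 1, and the good shares pull back to disjoint intervals of the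
   heavy copy, of total length at most 1. *)
have : (#|predC bad|%:R : R) <= w 0%N.
  rewrite -sumr_const -[leRHS]mulr1.
  apply: (@le_trans _ _ (\sum_(j in predC bad) nu (S j))).
    by apply: ler_sum => j _; rewrite nuE.
  rewrite (eq_bigr (fun j => w 0%N * unit_length (rho 0%N @^-1` S j))); last first.
    by move=> j jN; exact/(valuation_arc crho w m0)/good_arc.
  rewrite -big_distrr/= ler_wpM2l//; apply: sum_unit_length_itv.
    by move=> j jN; exact/(arc_interval crho m0 (cS j))/good_arc.
  by apply/trivIsetP => j k _ _ jk; rewrite -preimage_setI; move/trivIsetP: tS => ->.
apply/negP; rewrite -ltNge.
(* The contradiction: [n - V] good shares do not fit into the mass [f + (n - V - 1)]. *)
have : (n - V <= #|predC bad|)%N.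
  by rewrite leq_subLR (leq_trans _ (leq_add card_bad (leqnn _)))// cardC card_ord.
rewrite -(ler_nat R); apply: lt_le_trans.
by rewrite /w eqxx -(subnSK Vn) -natr1 addrC ltrD2l.
Qed.

(** * Changing a code by permutation, reversal and relabelling *)

Section recoding.
Variables (R : realType) (T : topologicalType).
Implicit Types (s : seq (nat * nat)) (t u : R) (rho : nat -> R -> T).

Lemma lab_end s i (b : bool) : lab s i (b%:R : R) = Some (end_lab s i b).
Proof. by rewrite /lab; case: b; rewrite ?eqxx ?oner_eq0. Qed.

Definition flip (r : bool) t : R := if r then 1 - t else t.

Lemma flipK r : involutive (flip r).
Proof. by case: r => t //=; rewrite /flip opprB addrC subrK. Qed.

Lemma flip_itv r t : 0 <= t <= 1 -> 0 <= flip r t <= 1.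
Proof. by case: r => //=; lra. Qed.

Lemma flip_end r (b : bool) : flip r b%:R = (b (+) r)%:R.
Proof. by case: r; case: b; rewrite /flip//= ?subrr ?subr0. Qed.

Lemma flip_clamp r t : flip r (clamp t) = clamp (flip r t).
Proof.
case: r => //=; rewrite /clamp !maxEle !minEle.
by do !case: ifP => /idP; lra.
Qed.

Lemma flip_continuous r : continuous (flip r).
Proof.
case: r => t /=; last exact: cvg_id.
by apply: continuousB; [exact: cst_continuous|exact: cvg_id].
Qed.

Lemma lab_flip s i (r : bool) t : 0 <= t <= 1 ->
  lab s i (flip r t) =
  if t == 0 then Some (end_lab s i r)
  else if t == 1 then Some (end_lab s i (~~ r)) else None.
Proof.
move=> t01; case: eqP => [->|t0].
  by rewrite -[0]/(false%:R) flip_end lab_end addFb.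
case: eqP => [->|t1].
  by rewrite -[1]/(true%:R) flip_end lab_end addTb.
rewrite /flip /lab; case: r; case: eqP => [h|_];
  by [exfalso; (apply: t0 || apply: t1); lra|
      case: eqP => [h|//]; exfalso; (apply: t0 || apply: t1); lra].
Qed.

(* [s'] is [s] with its copies permuted by [sigma] and reversed according to
   [r], with labels that induce the same gluing. *)
Lemma coding_iso s s' rho (sigma tau : nat -> nat) (r : nat -> bool) :
  size s' = size s ->
  (forall i, (i < size s)%N -> (sigma i < size s)%N /\ tau (sigma i) = i) ->
  (forall i, (i < size s)%N -> (tau i < size s)%N /\ sigma (tau i) = i) ->
  (forall i j b c, (i < size s)%N -> (j < size s)%N ->
    (end_lab s' i b == end_lab s' j c) =
    (end_lab s (sigma i) (b (+) r i) == end_lab s (sigma j) (c (+) r j))) ->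
  coding s rho -> coding s' (fun i t => rho (sigma i) (flip (r i) t)).
Proof.
move=> ss' sK tK labE crho; split; rewrite ?ss'.
- move=> U; rewrite (coding_open crho); split=> oU i im.
    have [sm _] := sK i im.
    by have /continuousP/(_ _ (oU _ sm)) := @flip_continuous (r i).
  have [tm ti] := tK i im; have := oU _ tm; rewrite ti => oU'.
  have /continuousP/(_ _ oU') := @flip_continuous (r (tau i)).
  by congr open; apply/funext => t /=; rewrite flipK.
- by move=> i t; rewrite (coding_clamp crho) flip_clamp.
- move=> i j t u im jm t01 u01.
  have [sim _] := sK i im; have [sjm _] := sK j jm.
  rewrite (coding_eq crho sim sjm (flip_itv _ t01) (flip_itv _ u01)).
  (* Interior parameters carry no label on either side; what is left are the four combinations of
     ends, given by [labE]. *)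
  have E : (lab s' i t != None /\ lab s' i t = lab s' j u) <->
      (lab s (sigma i) (flip (r i) t) != None /\
       lab s (sigma i) (flip (r i) t) = lab s (sigma j) (flip (r j) u)).
    rewrite !lab_flip// /lab.
    have L b c : Some (end_lab s' i b) = Some (end_lab s' j c) <->
        Some (end_lab s (sigma i) (b (+) r i)) = Some (end_lab s (sigma j) (c (+) r j)).
      by split=> -[/eqP E]; congr Some; apply/eqP; [rewrite -labE|rewrite labE].
    have L00 := L false false; have L01 := L false true.
    have L10 := L true false; have L11 := L true true.
    rewrite !addFb !addTb in L00 L01 L10 L11.
    case: (t =P 0) => _; [|case: (t =P 1) => _; last by split=> -[]];
      (case: (u =P 0) => _; [|case: (u =P 1) => _; last by split=> -[]]);
      split=> -[_ H]; split=> //;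
      by [apply: L00.1|apply: L01.1|apply: L10.1|apply: L11.1
         |apply: L00.2|apply: L01.2|apply: L10.2|apply: L11.2].
  rewrite E; split=> -[[ij tu]|?]; [left|by right|left|by right].
    have [_ <-] := sK i im; rewrite ij; have [_ ->] := sK j jm; split=> //.
    suff ijE : i = j by rewrite -(flipK (r i) t) tu ijE flipK.
    by have [_ <-] := sK i im; rewrite ij; have [_ ->] := sK j jm.
  by rewrite ij tu.
move=> x; have [i [t [im t01 <-]]] := coding_surj crho x.
have [tm ti] := tK i im; exists (tau i), (flip (r (tau i)) t); split=> //.
  exact: flip_itv.
by rewrite ti flipK.
Qed.

Definition codable s := exists rho, coding s rho.

Lemma codable_perm s s' : perm_eq s' s -> codable s -> codable s'.
Proof.
move=> /(perm_iotaP (0, 0)%N)[Is pIs ->] [rho crho].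
have uIs : uniq Is by rewrite (perm_uniq pIs) iota_uniq.
have sIs : size Is = size s by rewrite (perm_size pIs) size_iota.
have mIs i : (i \in Is) = (i < size s)%N by rewrite (perm_mem pIs) mem_iota.
eexists; apply: (@coding_iso s _ rho (nth 0%N Is) (index^~ Is) (fun=> false)) crho.
- by rewrite size_map.
- by move=> i im; rewrite -mIs mem_nth ?sIs// index_uniq ?sIs.
- by move=> i; rewrite -mIs => iIs; rewrite -sIs index_mem iIs nth_index.
- by move=> i j b c im jm; rewrite /end_lab !(nth_map 0%N) ?sIs// !addbF.
Qed.

Lemma codable_flip a b s : codable ((a, b) :: s) -> codable ((b, a) :: s).
Proof.
move=> [rho crho]; eexists.
apply: (@coding_iso _ _ rho id id (fun i => i == 0%N)) crho => //.
by move=> [|i] [|j] [] [].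
Qed.

Lemma codable_relabel (f : nat -> nat) s : {in labels s &, injective f} ->
  codable s -> codable [seq (f p.1, f p.2) | p <- s].
Proof.
move=> finj [rho crho]; eexists.
apply: (@coding_iso s _ rho id id (fun=> false)) crho => //; first by rewrite size_map.
move=> i j b c im jm; rewrite !addbF.
have fE k d : (k < size s)%N ->
    end_lab [seq (f p.1, f p.2) | p <- s] k d = f (end_lab s k d).
  by move=> km; rewrite /end_lab (nth_map (0, 0)%N)//; case: d.
by rewrite !fE//; apply/eqP/eqP => [/finj ->|->]//; exact: mem_end_lab.
Qed.

End recoding.

(** * Removing a vertex where two copy ends meet *)

Section degree_two.
Variables (R : realType) (T : topologicalType).
Implicit Types (s : seq (nat * nat)) (t u : R) (rho : nat -> R -> T).

Lemma mem_lab s i t l : (i < size s)%N -> lab s i t = Some l -> l \in labels s.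
Proof. by move=> im /lab_some[b [_ <-]]; exact: mem_end_lab. Qed.

(** The loop shares no label with the other copies, so its image is open and closed, and misses the
    nonempty copy [p]. *)
Lemma connected_loop l p s rho : connected [set: T] ->
  l \notin labels (p :: s) -> ~ coding ((l, l) :: p :: s) rho.
Proof.
move=> cT lN crho; pose U := rho 0%N @` [set t | 0 <= t <= 1].
have apart i t u : (i < size (p :: s))%N -> 0 <= t <= 1 -> 0 <= u <= 1 ->
    rho 0%N t <> rho i.+1 u.
  move=> im t01 u01 /(@coding_eq _ _ _ _ crho 0%N i.+1 t u isT im t01 u01)[[]//|[]].
  case E : (lab _ 0 t) => [l'|//] _ /esym E'.
  have ll' : l' = l by have [[] [_ <-]] := lab_some E.
  by move/negP : lN; apply; rewrite -ll'; exact: (mem_lab im E').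
have oU : open U.
  apply/(coding_open crho) => -[|i] im.
    rewrite (_ : _ @^-1` _ = setT); first exact: openT.
    by apply/seteqP; split=> // t _; exists (clamp t);
      [exact: clamp_itv|rewrite -(coding_clamp crho)].
  rewrite (_ : _ @^-1` _ = set0); first exact: open0.
  apply/seteqP; split=> // u -[t t01]; rewrite (coding_clamp crho i.+1).
  exact/apart/clamp_itv.
have oUC : open (~` U).
  apply/(coding_open crho) => -[|i] im.
    rewrite (_ : _ @^-1` _ = set0); first exact: open0.
    apply/seteqP; split=> // t; apply; exists (clamp t); first exact: clamp_itv.
    by rewrite -(coding_clamp crho).
  rewrite (_ : _ @^-1` _ = setT); first exact: openT.
  apply/seteqP; split=> // u _ [t t01]; rewrite (coding_clamp crho i.+1).
  exact/apart/clamp_itv.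
have i01 : 0 <= (0 : R) <= 1 by rewrite lexx ler01.
have : [set: T] `<=` U.
  apply: (connected_sub_open cT oU oUC); first exact: setICr.
    by rewrite setUCr.
  by exists (rho 0%N 0); split=> //; exists 0.
move=> /(_ (rho 1%N 0) I)[t t01]; exact: apart.
Qed.

(** The new copy runs through the first old copy on [0,1/2] and through the second on [1/2,1]. As
    [b] occurs nowhere else, the joint is glued to no further point and may lose its label. *)
Lemma codable_merge a b c s : b \notin [:: a, c & labels s] ->
  codable R T ((a, b) :: (b, c) :: s) -> codable R T ((a, c) :: s).
Proof.
move=> bN [rho crho]; set s1 := _ :: _ in crho; set s2 := (a, c) :: s.
(* Old copy and parameter of a new parameter; the joint [t = 1 / 2] is read as end 1 of the first
   copy. *)
pose dec (i : nat) t := if i is i'.+1 then (i.+1, t)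
  else if t <= 1 / 2 then (0%N, 2 * t) else (1%N, 2 * t - 1).
have dec_s1 i t : (i < size s2)%N -> ((dec i t).1 < size s1)%N.
  by case: i => [|i]//= _; case: ifP.
have dec_itv i t : 0 <= t <= 1 -> 0 <= (dec i t).2 <= 1.
  by case: i => [|i]//= t01; case: (lerP t (1 / 2)) => ? /=; lra.
have dec_inj i j t u : 0 <= t <= 1 -> 0 <= u <= 1 -> dec i t = dec j u -> i = j /\ t = u.
  case: i j => [|i] [|j] //= t01 u01; try by [case: ifP|move=> [-> ->]].
    by case: (lerP t (1 / 2)) => ?; case: (lerP u (1 / 2)) => ? // -[?]; split=> //; lra.
have lab_b i t : (i < size s2)%N -> lab s2 i t <> Some b.
  move=> im E; move/negP : bN; apply; exact: (mem_lab im E).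
(* The joint is the only place where old and new labels differ. *)
have lab_dec i t : (i < size s2)%N -> 0 <= t <= 1 ->
    lab s1 (dec i t).1 (dec i t).2 = lab s2 i t \/
    lab s1 (dec i t).1 (dec i t).2 = Some b /\ (i, t) = (0%N, 1 / 2).
  case: i => [|i]; last by left.
  move=> _ t01 /=; rewrite /lab.
  case: (lerP t (1 / 2)) => ? /=.
    have [->|t0] := eqVneq t 0; first by rewrite mulr0 eqxx; left.
    have [->|t12] := eqVneq t (1 / 2).
      have -> : 2 * (1 / 2) = 1 :> R by lra.
      by right; split=> //; rewrite oner_eq0 eqxx.
    left; have -> : (2 * t == 0) = false by apply/eqP => ?; move/eqP: t0; apply; lra.
    have -> : (2 * t == 1) = false by apply/eqP => ?; move/eqP: t12; apply; lra.
    by case: eqP => // ?; exfalso; lra.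
  left; have -> : (2 * t - 1 == 0) = false by apply/eqP => ?; lra.
  have -> : (t == 0) = false by apply/eqP => ?; lra.
  by have -> : (2 * t - 1 == 1) = (t == 1) by apply/eqP/eqP => ?; lra.
have i01 : 0 <= (0 : R) <= 1 by rewrite lexx ler01.
have i11 : 0 <= (1 : R) <= 1 by rewrite lexx ler01.
have joint : rho 0%N 1 = rho 1%N 0.
  apply/(coding_eq crho) => //; right.
  by rewrite -[1]/(true%:R) -[X in lab _ 1 X]/(false%:R) !lab_end.
have labN : lab s2 0 (1 / 2 : R) = None.
  rewrite /lab; have -> : (1 / 2 == 0 :> R) = false by apply/eqP => ?; lra.
  by have -> : (1 / 2 == 1 :> R) = false by apply/eqP => ?; lra.
pose rho' i t := rho (dec i t).1 (dec i t).2.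
have rho0 t : 0 <= t <= 1 -> rho' 0%N (t / 2) = rho 0%N t.
  move=> t01; rewrite /rho' /= ifT; last lra.
  by congr (rho _ _); rewrite /=; lra.
(* At [t = 0] the decoding lands on the first copy, hence the use of [joint]. *)
have rho1 t : 0 <= t <= 1 -> rho' 0%N ((t + 1) / 2) = rho 1%N t.
  move=> t01; rewrite /rho' /=; case: (lerP ((t + 1) / 2)) => ? /=.
    have t0 : t = 0 by lra.
    by rewrite t0 -joint; congr (rho _ _); lra.
  by congr (rho _ _); lra.
have halfC (h : R -> R) : continuous h -> forall (U : set T) i,
    open (rho' i @^-1` U) -> open ((fun t => rho' i (h t)) @^-1` U).
  by move=> /continuousP ch U i /ch.
exists rho'; split.
- move=> U; split=> oU.
    move=> [|i] im; last exact: (coding_open crho U).1 oU i.+2 im.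
    have cpre i (h : R -> R) : (i < size s1)%N -> continuous h ->
        open [set t | U (rho i (h t))].
      by move=> im1 /continuousP ch; exact: (ch _ ((coding_open crho U).1 oU i im1)).
    have cM : continuous (fun t : R => 2 * t) by move=> t; exact: mulrl_continuous.
    have cMB : continuous (fun t : R => 2 * t - 1).
      by move=> t; apply: cvgB; [exact: cM|exact: cvg_cst].
    have o0 := cpre 0%N _ isT cM; have o1 := cpre 1%N _ isT cMB.
    have before t : t <= 1 / 2 -> rho 1%N (2 * t - 1) = rho 1%N 0.
      move=> t12; rewrite (coding_clamp crho); congr (rho _ _).
      by rewrite /clamp max_l// ge_min; apply/orP; right; lra.
    have after t : 1 / 2 < t -> rho 0%N (2 * t) = rho 1%N 0.
      move=> t12; rewrite (coding_clamp crho) -joint; congr (rho _ _).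
      by rewrite /clamp min_l ?max_r//; lra.
    (* Off its own half, each of the two maps is constantly the joint. *)
    have [UB|UB] := pselect (U (rho 1%N 0)).
      rewrite (_ : _ @^-1` _ = [set t | U (rho 0%N (2 * t))] `&`
                              [set t | U (rho 1%N (2 * t - 1))]); first exact: openI.
      apply/seteqP; split=> t; rewrite /= /rho' /=; case: (lerP t (1 / 2)) => t12 /=.
      - by move=> ?; split=> //; rewrite before.
      - by move=> ?; split=> //; rewrite after.
      - by case.
      - by case.
    rewrite (_ : _ @^-1` _ = [set t | U (rho 0%N (2 * t))] `|`
                            [set t | U (rho 1%N (2 * t - 1))]); first exact: openU.
    apply/seteqP; split=> t; rewrite /= /rho' /=; case: (lerP t (1 / 2)) => t12 /=.
    - by left.
    - by right.
    - by case=> //; rewrite before.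
    - by case=> //; rewrite after.
  (* Conversely, each of the two old copies is a continuous reparametrization of one half of the new
     copy. *)
  apply/(coding_open crho) => -[|[|i]] im; last exact: oU i.+1 im.
    rewrite (_ : rho 0%N = fun t => rho' 0%N (clamp t / 2)).
      apply: halfC; last exact: oU.
      by move=> t; apply: cvgM; [exact: clamp_continuous|exact: cvg_cst].
    by apply/funext => t; rewrite rho0 ?clamp_itv// -(coding_clamp crho).
  rewrite (_ : rho 1%N = fun t => rho' 0%N ((clamp t + 1) / 2)).
    apply: halfC; last exact: oU.
    move=> t; apply: cvgM; last exact: cvg_cst.
    by apply: cvgD; [exact: clamp_continuous|exact: cvg_cst].
  by apply/funext => t; rewrite rho1 ?clamp_itv// -(coding_clamp crho).
- move=> [|i] t; last exact: (coding_clamp crho).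
  rewrite /rho' /=; have [t0|t0] := ltrP t 0.
    have -> : clamp t = 0 by rewrite /clamp max_l// ge_min (ltW t0) orbT.
    rewrite !ifT; [|lra..]; rewrite /= (coding_clamp crho) mulr0; congr (rho _ _).
    by rewrite /clamp max_l// ge_min; apply/orP; right; lra.
  have [t1|t1] := ltrP 1 t; last by rewrite clamp_id// t0.
  have -> : clamp t = 1 by rewrite /clamp min_l ?max_r// ltW.
  rewrite !ifF; [|lra..]; rewrite /= (coding_clamp crho).
  by congr (rho _ _); rewrite /clamp min_l ?max_r//; lra.
- move=> i j t u im jm t01 u01.
  rewrite (coding_eq crho (dec_s1 i t im) (dec_s1 j u jm) (dec_itv i t t01) (dec_itv j u u01)).
  split=> [[[ij tu]|[]]|[[-> ->]|[]]].
  + by left; apply: dec_inj => //; case: (dec i t) (dec j u) ij tu => ? ? [? ?] /= -> ->.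
  + have [Li|[Li Ei]] := lab_dec i t im t01; have [Lj|[Lj Ej]] := lab_dec j u jm u01.
    * by rewrite Li Lj; right.
    * by rewrite Li Lj => _ /lab_b -/(_ im).
    * by rewrite Li Lj => _ /esym /lab_b -/(_ jm).
    * by move=> _ _; left; case: Ei Ej => -> -> [-> ->].
  + by left.
  + have [Li|[Li [-> ->]]] := lab_dec i t im t01; have [Lj|[Lj [-> ->]]] := lab_dec j u jm u01.
    * by rewrite Li Lj; right.
    * by rewrite labN => tN E; move: tN; rewrite E.
    * by rewrite labN.
    * by left.
move=> x; have [[|[|i]] [t [im t01 <-]]] := coding_surj crho x.
- by exists 0%N, (t / 2); split=> //; [lra|exact: rho0].
- by exists 0%N, ((t + 1) / 2); split=> //; [lra|exact: rho1].
- by exists i.+1, t; split.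
Qed.

End degree_two.

(** * Shortening and normalizing codes *)

Section reduction.
Variables (R : realType) (T : topologicalType).
Local Notation codable := (codable R T).

Lemma perm_labels s s' : perm_eq s s' -> perm_eq (labels s) (labels s').
Proof. by move=> ss'; apply/perm_flatten/perm_map. Qed.

(** Moves a copy with an end labelled [l] to the front, reversed if necessary. The untouched prefix
    [r] allows a second application after a first copy has been set aside. *)
Lemma codable_label_head (l : nat) r s : l \in labels s -> codable (r ++ s) ->
  exists a s', codable ((l, a) :: r ++ s') /\ perm_eq (labels s) [:: l, a & labels s'].
Proof.
move=> /flattenP[_ /mapP[[x y] xys ->]]; rewrite !inE /= => lxy crs.
have srem := perm_to_rem xys; set s' := rem (x, y) s in srem.
have crs' : codable ((x, y) :: r ++ s').
  apply: codable_perm crs; rewrite perm_sym.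
  by rewrite (perm_catl r srem) (perm_catCA r [:: (x, y)] s').
have := perm_labels srem; rewrite /= => perm_s.
case/orP: lxy => /eqP->; first by exists y, s'.
exists x, s'; split; first exact: codable_flip.
by rewrite (permPl perm_s) (perm_catCA [:: x] [:: y] (labels s')).
Qed.

(** If both occurrences of [l] are on one copy, this copy is an isolated loop, against
    connectedness; otherwise the two copies merge at [l]. *)
Lemma codable_degree_two (l : nat) s : connected [set: T] -> codable s ->
  (1 < size s)%N -> count_mem l (labels s) = 2%N ->
  exists s', [/\ codable s', s' <> [::] & (size s' < size s)%N].
Proof.
move=> cT cs s_gt1 l2; have ls : l \in labels s by rewrite -has_pred1 has_count l2.
have [a [s1 [cs1 perm_s]]] := @codable_label_head l [::] s ls cs.
have size_s : size s = (size s1).+1.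
  by have := perm_size perm_s; rewrite /= !size_labels; lia.
have := permP perm_s (pred1 l); rewrite l2 /= eqxx.
have [al|al] := eqVneq a l => /= l1.
  case: s1 cs1 size_s l1 {perm_s} => [|p s1] cs1 size_s l1; first by rewrite size_s in s_gt1.
  have [rho crho] := cs1; exfalso; apply: (connected_loop cT _ _ (rho := rho)).
    2: by rewrite al in crho; exact: crho.
  by rewrite -has_pred1 has_count -leqNgt leqn0; apply/eqP; case: l1.
have l1' : count_mem l (labels s1) = 1%N by case: l1.
have ls1 : l \in labels s1 by rewrite -has_pred1 has_count l1'.
have cs1' := codable_flip cs1.
have [c [s2 [cs2 perm_s1]]] := @codable_label_head l [:: (a, l)] s1 ls1 cs1'.
have size_s1 : size s1 = (size s2).+1.
  by have := perm_size perm_s1; rewrite /= !size_labels; lia.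
exists ((a, c) :: s2); split=> //; last by rewrite size_s size_s1 /= ltnS.
apply: (@codable_merge _ _ a l c).
  have := permP perm_s1 (pred1 l); rewrite l1' /= eqxx.
  have [//|cl] := eqVneq c l; move=> ls2.
  have {}ls2 : count_mem l (labels s2) = 0%N by case: ls2.
  by rewrite !inE eq_sym (negPf al) eq_sym (negPf cl) -has_pred1 has_count ls2.
by apply: codable_perm cs2; rewrite (perm_catCA [:: (a, l)] [:: (l, c)] s2).
Qed.

(** Replacing each label by its index among the distinct labels leaves finitely many codes of a
    given length. *)
Lemma codable_normal s : codable s ->
  exists s', [/\ codable s', size s' = size s &
    {in labels s', forall l, (l < size (undup (labels s')))%N}].
Proof.
move=> cs; pose U := undup (labels s); pose f l := index l U.
have finj : {in labels s &, injective f}.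
  by move=> k l ks ls; apply: (@index_inj _ 0%N U); rewrite mem_undup.
pose s' := [seq (f p.1, f p.2) | p <- s].
have labs' : labels s' = map f (labels s).
  by rewrite /s' /labels; elim: (s) => //= p r ->.
exists s'; split; [exact: codable_relabel|by rewrite size_map|].
move=> l; rewrite labs' => /mapP[k ks ->]; apply: (@leq_trans (size U)).
  by rewrite index_mem mem_undup.
rewrite -(size_map f); apply: uniq_leq_size.
  by rewrite map_inj_in_uniq ?undup_uniq// => ? ?; rewrite !mem_undup; exact: finj.
by move=> _ /mapP[j + ->]; rewrite !mem_undup => ?; exact: map_f.
Qed.

End reduction.

(** * Finite enumeration of the reduced codes *)

(** A computable form of the hypotheses of [coding_iso], trying all permutations and reversals.
    Three reversal flags suffice for codes of at most three copies. *)
Definition isomorphic_codes (s s0 : seq (nat * nat)) : bool :=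
  let m := size s in let I := iota 0 m in let B := [:: false; true] in
  (size s0 == m) &&
  has (fun sigma => has (fun r =>
    all (fun i => all (fun j => all (fun b => all (fun c =>
      (end_lab s0 i b == end_lab s0 j c) ==
      (end_lab s (nth 0%N sigma i) (b (+) nth false r i) ==
       end_lab s (nth 0%N sigma j) (c (+) nth false r j))) B) B) I) I)
    [seq a :: r | a <- B, r <- [seq [:: b; c] | b <- B, c <- B]])
  (permutations I).

Definition basic_codes := [:: interval_code; circle_code; lollipop_code;
  figure8_code; handcuffs_code; theta_code].

(** What is known of a shortest code out of reach of the counting argument. A single copy is exempt
    from the second condition: the label of the circle has multiplicity 2 but joins no two
    copies. *)
Definition reduced (s : seq (nat * nat)) : bool :=
  (size s <= (size (branch s)).+1)%N &&
  ((size s == 1%N) || all (fun l => count_mem l (labels s) != 2%N) (labels s)).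

Definition small_codes : seq (seq (nat * nat)) :=
  let P := [:: (0, 0); (0, 1); (1, 0); (1, 1)]%N in
  [seq [:: p] | p <- P] ++ [seq [:: p; q] | p <- P, q <- P] ++
  [seq p :: r | p <- P, r <- [seq [:: q; q'] | q <- P, q' <- P]].

(** Exhaustive check of 4 + 16 + 64 codes. *)
Lemma reduced_small_codes_basic :
  all (fun s => reduced s ==> has (isomorphic_codes s) basic_codes) small_codes.
Proof. by vm_compute. Qed.

Lemma isomorphic_codes_codable (R : realType) (T : topologicalType) s s0 :
  isomorphic_codes s s0 -> codable R T s -> codable R T s0.
Proof.
move=> /andP[/eqP ss0 /hasP[sigma + /hasP[r _ /allP lab_eq]]] [rho crho].
rewrite mem_permutations => psigma.
have usigma : uniq sigma by rewrite (perm_uniq psigma) iota_uniq.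
have szs : size sigma = size s by rewrite (perm_size psigma) size_iota.
have mems i : (i \in sigma) = (i < size s)%N by rewrite (perm_mem psigma) mem_iota.
eexists; apply: (@coding_iso R T s s0 rho (nth 0%N sigma) (index^~ sigma) (nth false r)) crho.
- by [].
- by move=> i im; rewrite -mems mem_nth ?szs// index_uniq ?szs.
- by move=> i; rewrite -mems => iIs; rewrite -szs index_mem iIs nth_index.
have memB b : b \in [:: false; true] by case: b.
move=> i j b c im jm.
have := lab_eq i; rewrite mem_iota => /(_ im)/allP/(_ j); rewrite mem_iota => /(_ jm).
by move=> /allP/(_ b (memB b))/allP/(_ c (memB c))/eqP.
Qed.

Lemma sum_count_undup (l : seq nat) :
  (\sum_(x <- undup l) count_mem x l)%N = size l.
Proof.
rewrite -[RHS](perm_size (perm_count_undup l)) size_flatten /shape -map_comp sumnE big_map.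
by apply: eq_bigr => x _; rewrite /= size_nseq.
Qed.

Lemma reduced_bound s : s <> [::] -> reduced s ->
  (size s <= 3)%N /\ (size (undup (labels s)) <= 2)%N.
Proof.
move=> s0 /andP[sV /orP[/eqP s1|/allP deg]].
  by split; rewrite ?s1// (leq_trans (size_undup _))// size_labels s1.
(* The labels have multiplicities adding up to 2m, and at least 3 on branches. *)
have : (size (undup (labels s)) + (size (branch s)).*2 <= size (labels s))%N.
  rewrite -sum_count_undup /branch.
  have : {subset undup (labels s) <= labels s} by move=> x; rewrite mem_undup.
  elim: (undup (labels s)) => [|x l IH] sub; first by rewrite big_nil.
  have /IH {}IH : {subset l <= labels s}.
    by move=> y yl; apply: sub; rewrite inE yl orbT.
  have xs := sub x (mem_head _ _).
  have x0 : (0 < count_mem x (labels s))%N by rewrite -has_count has_pred1.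
  have x2 := deg x xs.
  by move: IH x0 x2; rewrite big_cons /=; case: ifP => /=; lia.
(* With [L] distinct labels, [L + 2V <= 2m <= 2V + 2] gives [L <= 2]; then [V <= L] and [m <= V + 1]
   give [m <= 3]. *)
rewrite size_labels.
have : (size (branch s) <= size (undup (labels s)))%N by rewrite size_filter count_size.
have : (0 < size s)%N by case: (s) s0.
lia.
Qed.

Lemma mem_small_codes s : s <> [::] -> (size s <= 3)%N ->
  {in labels s, forall l, (l < 2)%N} -> s \in small_codes.
Proof.
pose P := [:: (0, 0); (0, 1); (1, 0); (1, 1)]%N.
have memP p : (p.1 < 2)%N -> (p.2 < 2)%N -> p \in P by case: p => [[|[|?]] [|[|?]]].
move=> s0 s3 lt2.
have sP : {subset s <= P}.
  move=> p ps; have pl l : l \in [:: p.1; p.2] -> (l < 2)%N.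
    by move=> lp; apply: lt2; apply/flattenP; exists [:: p.1; p.2] => //; exact: map_f.
  by apply: memP; apply: pl; rewrite !inE eqxx ?orbT.
rewrite /small_codes -/P.
clearbody P; case: s {lt2} s0 s3 sP => [|p [|q [|r [|]]]] // _ _ sP.
- by rewrite mem_cat; apply/orP; left; apply/mapP; exists p => //; apply: sP; rewrite inE.
- rewrite mem_cat; apply/orP; right; rewrite mem_cat; apply/orP; left.
  by apply/allpairsP; exists (p, q); split=> //=; apply: sP; rewrite !inE eqxx ?orbT.
rewrite mem_cat; apply/orP; right; rewrite mem_cat; apply/orP; right.
apply/allpairsP; exists (p, [:: q; r]).
split=> //=; first by apply: sP; rewrite mem_head.
by apply/allpairsP; exists (q, r); split=> //=; apply: sP; rewrite !inE eqxx ?orbT.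
Qed.

(** * Shortest codes and the conclusion *)

Theorem theorem2p6 (R : realType) (T : topologicalType)
    (tangleT : tangle R T) (not_basic : ~ basic_stringable R T) :
  exists n0 : nat, (0 < n0)%N /\
    forall n : nat, (n0 < n)%N -> ~ guarantees_envy_free R T n.
Proof.
have [cT [s0 s0N /(homeomorphic_coding R T s0N) cs0]] := tangleT.
pose P k := `[< exists s, [/\ codable R T s, s <> [::] & size s = k] >].
have exP : exists k, P k by exists (size s0); apply/asboolP; exists s0.
have [k /asboolP[s1 [cs1 s1N sk]] kmin] := ex_minnP exP.
(* Normalization preserves the length, so [s] is still a shortest code. *)
have [s [cs ss1 lab_lt]] := codable_normal cs1.
have sN : s <> [::] by move=> s_nil; case: s1 s1N ss1 {cs1 sk} => //; rewrite s_nil.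
have [rho crho] := cs.
have [Vm|mV] := leqP (size (branch s)).+2 (size s).
  (* The successor keeps [n0] positive when there is no branch label. *)
  exists (size (branch s)).+1; split=> // n nV.
  by apply: (coding_not_guarantees crho Vm); exact: ltnW.
exfalso; apply: not_basic.
have reds : reduced s.
  (* In a code of several copies a label of multiplicity 2 would lead to a shorter code, against
     minimality. *)
  rewrite /reduced -ltnS mV /=; case: eqVneq => //= s_neq1.
  apply/allP => l ls; apply/negP => /eqP l2.
  have [|s' [cs' s'N lt_s']] := codable_degree_two cT cs _ l2.
    by rewrite ltn_neqAle eq_sym s_neq1 lt0n size_eq0; exact/eqP.
  have : (size s1 <= size s')%N.
    by rewrite sk; apply: kmin; apply/asboolP; exists s'.
  by rewrite leqNgt -ss1 lt_s'.
have [s3 U2] := reduced_bound sN reds.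
have s_small : s \in small_codes.
  by apply: mem_small_codes => // l /lab_lt /leq_trans; apply.
have /implyP/(_ reds)/hasP[b bB iso] := allP reduced_small_codes_basic _ s_small.
exists b => //; apply/homeomorphic_coding; last exact: isomorphic_codes_codable iso cs.
by move=> b0; move: bB; rewrite b0.
Qed.
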